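(* Let $\{Q_i\}_{i\in\Lambda}$ be a set of key polynomials for $\nu$. If $\Lambda$ has a maximal element $i$ and $\beta_i=\nu(Q_i)\notin\tilde\Gamma_0$, then $\mathrm{in}_\nu Q_i$ is transcendental over $G_{\nu_K}[\mathrm{in}_\nu\mathbf Q_i]$, where $\mathbf Q_i=\{Q_q\}_{q<i}$.
   Context: Setting. $K\subset K(x)$ is a simple transcendental extension, $\nu$ a valuation of $K(x)$ with value group $\Gamma$, $\nu_K=\nu|_K$ with value group $\Gamma_0$; $\operatorname{rank}\nu_K=1$, $\nu(x)>0$. $\tilde\Gamma_0=\Gamma_0\otimes_{\mathbb Z}\mathbb Q$, with a fixed ordered embedding into $\mathbb R$; values are compared in $\Gamma\otimes\mathbb Q$. $\mathbb N$ = positive integers, $\mathbb N_0=\mathbb N\cup\{0\}$. $G_\nu=\bigoplus_{\beta\in\Gamma}\mathbf P_\beta/\mathbf P_{\beta+}$ with $\mathbf P_\beta=\{y\in K(x):\nu(y)\ge\beta\}$, $\mathbf P_{\beta+}=\{y:\nu(y)>\beta\}$; $\mathrm{in}_\nu y$ is the class of $y$ in degree $\nu(y)$; $G_{\nu_K}$ is the analogous algebra for $(K,\nu_K)$. For a graded domain $G$, $G^*=\{g/h: g,h\in G,\ h\ne0 \text{ homogeneous}\}$. Index sets. $\Lambda$ is a countable well ordered set with least element $0$; $i+1$ is the successor of $i$, etc. $(\alpha_i)_{i\in\Lambda}$ are positive integers, $\alpha_0=1$. $i$ is inessential if $i+\omega\in\Lambda$ and $\alpha_{i+t}=1$ for all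 $t\in\mathbb N_0$. For non-maximal $i$, $i+$ denotes $i+\omega$ if $i$ is inessential, and $i+1$ otherwise. Pre-key polynomials: monic $Q_i\in K[x]$ $(i\in\Lambda)$, $Q_0=x$, with $\deg Q_i=\alpha_i\deg Q_{i_0}$ for all non-maximal $i\ge1$ and $i_0<i$ with $i_0+=i$. Put $\beta_i=\nu(Q_i)$, $\bar\alpha_i=\deg_xQ_i$, $\mathbf Q_i=\{Q_q\}_{q<i}$. Standard expansions. An $\ell$-standard monomial is $c\prod_{i\le\ell}Q_i^{\gamma_i}$, $c\in K$, $\gamma_i\in\mathbb N_0$ almost all $0$, with $\gamma_i<\alpha_{i+}$ for $i<\ell$ and, for each inessential $i$, at most one $j$ with $j+=i+$ and $\gamma_j\neq0$ (here $i+$ is computed in $\{q\in\Lambda:q\le\ell\}$). It is $Q_\ell$-free if $\gamma_\ell=0$. A $Q_\ell$-free $\ell$-standard expansion is a finite sum of $Q_\ell$-free $\ell$-standard monomials whose $\nu$-value is the minimum of the values of the monomials. An $\ell$-standard expansion of $g\in K[x]$ is $g=\sum_jc_jQ_\ell^j$ with each $c_j$ a $Q_\ell$-free $\ell$-standard expansion. Set of key polynomials for $\nu$: a set of pre-key polynomials such that (a) $\beta_i\in\tilde\Gamma_0$ for $i\ne\max\Lambda$; (b) if $i\ge1$ has an immediate predecessor, $Q_i$ has an $(i-1)$-standard expansion $Q_i=Q_{i-1}^{\alpha_i}+\sum_{j<\alpha_i}\big(\sum_\gamma c_{j,\gamma}M_\gamma\big)Q_{i-1}^j$ where the $c_{j,\gamma}M_\gamma$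 are $Q_{i-1}$-free $(i-1)$-standard monomials ($c_{j,\gamma}\in K$, $M_\gamma$ a product of powers of elements of $\mathbf Q_{i-1}$; elements of $K$ if $i=1$), all the monomials appearing have the same $\nu$-value, and $(\mathrm{in}_\nu Q_{i-1})^{\alpha_i}+\sum_{j}\big(\sum_\gamma \mathrm{in}_{\nu_K}c_{j,\gamma}\,\mathrm{in}_\nu M_\gamma\big)(\mathrm{in}_\nu Q_{i-1})^j=0$ is the minimal algebraic relation of $\mathrm{in}_\nu Q_{i-1}$ over $G_{\nu_K}[\mathrm{in}_\nu\mathbf Q_{i-1}]^*$; (c) if $i\geq 1$ has no immediate predecessor, there is $i_0$ with $i_0+=i$, and for every such $i_0$ there is an $i_0$-standard expansion $Q_i=\sum_{j=0}^{\alpha_i}c_{j,i_0}Q_{i_0}^j$; every such expansion satisfies $\nu(Q_i)>\min_j\nu(c_{j,i_0}Q_{i_0}^j)$, and $Q_i$ has the smallest degree among polynomials with this property for all $i_0$ with $i_0+=i$; if $\{\beta_{i'}:i'<i\}$ is bounded in $\tilde\Gamma_0$ (in particular if $i\ne\max\Lambda$) then $c_{\alpha_i,i_0}=1$ and $\min_j\nu(c_{j,i_0}Q_{i_0}^j)=\alpha_i\beta_{i_0}=\nu(c_{0,i_0})$; (d) if for some $n$ the set $\{i:\deg Q_i=n\}$ is infinite, then $\{\nu(Q_i):\deg Q_i=n\}$ is cofinal in $\{\nu(f): f\in K[x]\text{ monic},\deg f=n\}$. *)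

(* Defs.v *)
From HB Require Import structures.
From mathcomp Require Import all_boot all_order all_algebra.
From mathcomp Require Import finmap.
From mathcomp Require Import boolp classical_sets functions cardinality wochoice.
From mathcomp Require Import ring_quotient fraction.
From mathcomp Require Import monalg.

Set Implicit Arguments.
Unset Strict Implicit.
Unset Printing Implicit Defensive.

Import Order.TTheory GRing.Theory.
Local Open Scope classical_set_scope.
Local Open Scope ring_scope.
Local Open Scope quotient_scope.

(* Totally ordered abelian groups: MathComp's [porderZmodType] requires neither
   totality nor the compatibility of order and sum. *)
HB.mixin Record isOrderedGroup G of Num.POrderedZmodule G := {
  ole_total : total (<=%R : rel G);
  oleD2r_subproof : forall c a b : G, a <= b -> a + c <= b + c
}.

#[short(type="orderedGroupType")]
HB.structure Definition OrderedGroup :=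
  {G of isOrderedGroup G & Num.POrderedZmodule G}.

Section OrderedGroupTheory.
Context {G : orderedGroupType}.
Implicit Types a b c d : G.

Lemma ocomparable a b : a >=< b.
Proof. exact: ole_total. Qed.

Lemma oleNgt a b : (a <= b) = ~~ (b < a).
Proof. exact/comparable_leNgt/ocomparable. Qed.

Lemma oltNge a b : (a < b) = ~~ (b <= a).
Proof. exact/comparable_ltNge/ocomparable. Qed.

Lemma ole_min a b c : (a <= Order.min b c) = (a <= b) && (a <= c).
Proof. exact/comparable_le_min/ocomparable. Qed.

Lemma olt_min a b c : (a < Order.min b c) = (a < b) && (a < c).
Proof. exact/comparable_lt_min/ocomparable. Qed.

Lemma oleD2r c a b : (a + c <= b + c) = (a <= b).
Proof.
apply/idP/idP => [h|]; last exact: oleD2r_subproof.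
by rewrite -[a](addrK c) -[b](addrK c); exact: oleD2r_subproof.
Qed.

Lemma oleD2l c a b : (c + a <= c + b) = (a <= b).
Proof. by rewrite ![c + _]addrC oleD2r. Qed.

Lemma oltD2r c a b : (a + c < b + c) = (a < b).
Proof. by rewrite !lt_leAnge !oleD2r. Qed.

Lemma oltD2l c a b : (c + a < c + b) = (a < b).
Proof. by rewrite ![c + _]addrC oltD2r. Qed.

Lemma oleD a b c d : a <= b -> c <= d -> a + c <= b + d.
Proof. by move=> ab cd; apply: (@le_trans _ _ (b + c)); rewrite ?oleD2r ?oleD2l. Qed.

Lemma oltleD a b c d : a < b -> c <= d -> a + c < b + d.
Proof. by move=> ab cd; apply: (@lt_le_trans _ _ (b + c)); rewrite ?oltD2r ?oleD2l. Qed.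

Lemma oleltD a b c d : a <= b -> c < d -> a + c < b + d.
Proof. by move=> ab cd; rewrite addrC [b + d]addrC; exact: oltleD. Qed.

End OrderedGroupTheory.

(* A valuation is only meaningful on nonzero elements; [ext_val] below adds the
   value infinity at zero. *)
Record valuation (F : fieldType) (G : orderedGroupType) := Valuation {
  val_fun :> F -> G;
  valM : forall x y, x != 0 -> y != 0 -> val_fun (x * y) = val_fun x + val_fun y;
  valD : forall x y, x != 0 -> y != 0 -> x + y != 0 ->
    Order.min (val_fun x) (val_fun y) <= val_fun (x + y)
}.

Section ValuationTheory.
Context {F : fieldType} {G : orderedGroupType} (v : valuation F G).

(* The subgroups P_b and P_{b+} *)
Definition vge (b : G) : {pred F} := [pred y | (y == 0) || (b <= v y)].
Definition vgt (b : G) : {pred F} := [pred y | (y == 0) || (b < v y)].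

Lemma val1 : v 1 = 0.
Proof.
have /= := valM v (oner_neq0 F) (oner_neq0 F).
by rewrite mulr1 -[X in X = _]addr0 => /addrI.
Qed.

Lemma valN y : v (- y) = v y.
Proof.
have [->|y0] := eqVneq y 0; first by rewrite oppr0.
have N1 : (-1 : F) != 0 by rewrite oppr_eq0 oner_neq0.
have e : v (-1) + v (-1) = 0 by rewrite -valM // mulN1r opprK val1.
have : v (-1) = 0.
  case: (comparable_ltgtP (ocomparable (v (-1)) 0)) => // h.
    by have := oltleD h (ltW h); rewrite addr0 e ltxx.
  by have := oltleD h (ltW h); rewrite addr0 e ltxx.
by move=> v0; rewrite -mulN1r valM // v0 add0r.
Qed.

Fact vge_zmod b : zmod_closed (vge b).
Proof.
split; first by rewrite inE eqxx.
move=> x y; rewrite !inE.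
have [->|x0 /= bx] := eqVneq x 0; first by rewrite sub0r oppr_eq0 valN.
have [->|y0 /= by_] := eqVneq y 0; first by rewrite subr0 (negPf x0) bx.
have [//|xy0 /=] := eqVneq (x - y) 0.
have Ny : - y != 0 by rewrite oppr_eq0.
by apply: le_trans (valD v x0 Ny xy0); rewrite ole_min bx valN.
Qed.

Fact vgt_zmod b : zmod_closed (vgt b).
Proof.
split; first by rewrite inE eqxx.
move=> x y; rewrite !inE.
have [->|x0 /= bx] := eqVneq x 0; first by rewrite sub0r oppr_eq0 valN.
have [->|y0 /= by_] := eqVneq y 0; first by rewrite subr0 (negPf x0) bx.
have [//|xy0 /=] := eqVneq (x - y) 0.
have Ny : - y != 0 by rewrite oppr_eq0.
by apply: lt_le_trans (valD v x0 Ny xy0); rewrite olt_min bx valN.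
Qed.

HB.instance Definition _ b := GRing.isZmodClosed.Build F (vge b) (vge_zmod b).
HB.instance Definition _ b := GRing.isZmodClosed.Build F (vgt b) (vgt_zmod b).

Lemma vgtW b y : y \in vgt b -> y \in vge b.
Proof. by rewrite !inE => /orP[->//|/ltW->]; rewrite orbT. Qed.

Lemma vgeM a b x y : x \in vge a -> y \in vge b -> x * y \in vge (a + b).
Proof.
rewrite !inE mulf_eq0.
have [//|x0 /= ax] := eqVneq x 0; have [//|y0 /= by_] := eqVneq y 0.
by rewrite valM // oleD.
Qed.

Lemma vgtMl a b x y : x \in vgt a -> y \in vge b -> x * y \in vgt (a + b).
Proof.
rewrite !inE mulf_eq0.
have [//|x0 /= ax] := eqVneq x 0; have [//|y0 /= by_] := eqVneq y 0.
by rewrite valM // oltleD.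
Qed.

Lemma vgtMr a b x y : x \in vge a -> y \in vgt b -> x * y \in vgt (a + b).
Proof. by move=> ? ?; rewrite mulrC addrC vgtMl. Qed.

Lemma vge_lt a b x : a < b -> x \in vge b -> x \in vgt a.
Proof. by move=> ab; rewrite !inE => /orP[->//|/(lt_le_trans ab)->]; rewrite orbT. Qed.

Lemma vgeNvgt b x : x \in vge b -> x \notin vgt b -> x != 0 /\ v x = b.
Proof.
rewrite !inE negb_or; case/orP=> [-> //|bx /andP[-> /=]].
by rewrite -oleNgt => xb; split=> //; apply/le_anti/andP.
Qed.

End ValuationTheory.

(* Pullback of a valuation, e.g. its restriction to a subfield *)
Section PullVal.
Context {K F : fieldType} {G : orderedGroupType}.
Variables (f : {rmorphism K -> F}) (v : valuation F G).

Fact pull_valM x y : x != 0 -> y != 0 -> v (f (x * y)) = v (f x) + v (f y).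
Proof. by move=> x0 y0; rewrite rmorphM valM ?fmorph_eq0. Qed.

Fact pull_valD x y : x != 0 -> y != 0 -> x + y != 0 ->
  Order.min (v (f x)) (v (f y)) <= v (f (x + y)).
Proof.
move=> x0 y0 xy0; rewrite rmorphD; apply: valD; rewrite ?fmorph_eq0 //.
by rewrite -rmorphD fmorph_eq0.
Qed.

Definition pull_val : valuation K G :=
  @Valuation K G (fun c => v (f c)) pull_valM pull_valD.

End PullVal.

(* ** The group algebra F[G] *)

Definition galg (F : fieldType) (G : orderedGroupType) := {malg F[G]}.

Section GroupAlgebra.
Context {F : fieldType} {G : orderedGroupType}.
Local Notation A := (galg F G).
Implicit Types g : A.

HB.instance Definition _ := GRing.Zmodule.on A.

Local Open Scope fset_scope.

Definition ga_one : A := << 1 *g (0 : G) >>.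

Definition ga_mul (g1 g2 : A) : A :=
  \sum_(k1 <- msupp g1) \sum_(k2 <- msupp g2)
    << mcoeff k1 g1 * mcoeff k2 g2 *g (k1 + k2)%R >>.

Lemma ga_mulw (d1 d2 : {fset G}) g1 g2 :
  msupp g1 `<=` d1 -> msupp g2 `<=` d2 ->
  ga_mul g1 g2 = \sum_(k1 <- d1) \sum_(k2 <- d2)
    << mcoeff k1 g1 * mcoeff k2 g2 *g (k1 + k2)%R >>.
Proof.
move=> le_d1 le_d2; rewrite /ga_mul (big_fset_incl _ le_d1) /=.
  apply/eq_bigr=> k1 _; apply/big_fset_incl => // k _ /mcoeff_outdom ->.
  by rewrite mulr0 monalgU0.
move=> k _ /mcoeff_outdom g1k.
by rewrite big1 => // k' _; rewrite g1k mul0r monalgU0.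
Qed.

Lemma ga_mulC : commutative ga_mul.
Proof.
move=> g1 g2; rewrite /ga_mul exchange_big /=.
apply/eq_bigr=> k1 _; apply/eq_bigr=> k2 _.
by rewrite mulrC addrC.
Qed.

Lemma ga_mul0g : left_zero 0 ga_mul.
Proof. by move=> g; rewrite /ga_mul msupp0 big_seq_fset0. Qed.

Lemma ga_mulDl : left_distributive ga_mul +%R.
Proof.
move=> g1 g2 g.
rewrite [in RHS](ga_mulw (fsubsetUl _ (msupp g2)) (fsubset_refl _)).
rewrite [in RHS](ga_mulw (fsubsetUr (msupp g1) _) (fsubset_refl _)).
rewrite (ga_mulw (msuppD_le _ _) (fsubset_refl _)).
rewrite -big_split /=; apply/eq_bigr=> k1 _.
rewrite -big_split /=; apply/eq_bigr=> k2 _.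
by rewrite mcoeffD mulrDl monalgUD.
Qed.

Lemma ga_mulUU (c1 c2 : F) (k1 k2 : G) :
  ga_mul << c1 *g k1 >> << c2 *g k2 >> = << c1 * c2 *g (k1 + k2)%R >>.
Proof. by rewrite (ga_mulw msuppU_le msuppU_le) !big_seq_fset1 !mcoeffUU. Qed.

Lemma ga_mul_suml (I : Type) (r : seq I) (E : I -> A) g :
  ga_mul (\sum_(i <- r) E i) g = \sum_(i <- r) ga_mul (E i) g.
Proof. exact: (big_morph (ga_mul^~ _) (fun _ _ => ga_mulDl _ _ _) (ga_mul0g _)). Qed.

Lemma ga_mul_sumr (I : Type) (r : seq I) (E : I -> A) g :
  ga_mul g (\sum_(i <- r) E i) = \sum_(i <- r) ga_mul g (E i).
Proof. by rewrite ga_mulC ga_mul_suml; apply/eq_bigr => i _; rewrite ga_mulC. Qed.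

Lemma ga_mulA : associative ga_mul.
Proof.
move=> g1 g2 g3; rewrite [g1]monalgE [LHS]ga_mul_suml.
rewrite [X in _ = ga_mul X g3]ga_mul_suml [RHS]ga_mul_suml.
apply/eq_bigr=> k1 _; rewrite [g2]monalgE [X in ga_mul _ X = _]ga_mul_suml.
rewrite [LHS]ga_mul_sumr [X in _ = ga_mul X g3]ga_mul_sumr [RHS]ga_mul_suml.
apply/eq_bigr=> k2 _; rewrite [g3]monalgE [X in ga_mul _ X = _]ga_mul_sumr.
rewrite [LHS]ga_mul_sumr [RHS]ga_mul_sumr; apply/eq_bigr=> k3 _.
by rewrite !ga_mulUU mulrA addrA.
Qed.

Lemma ga_mul1g : left_id ga_one ga_mul.
Proof.
move=> g; rewrite [g in LHS]monalgE ga_mul_sumr [RHS]monalgE.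
by apply/eq_bigr=> k _; rewrite /ga_one ga_mulUU mul1r add0r.
Qed.

Lemma ga_one_neq0 : ga_one != 0.
Proof. by rewrite monalgU_eq0 oner_eq0. Qed.

HB.instance Definition _ := GRing.Zmodule_isComNzRing.Build A
  ga_mulA ga_mulC ga_mul1g ga_mulDl ga_one_neq0.

Lemma ga_mcoeffM g1 g2 b :
  mcoeff b (g1 * g2 : A) = \sum_(k1 <- msupp g1) \sum_(k2 <- msupp g2)
    (mcoeff k1 g1 * mcoeff k2 g2) *+ (k1 + k2 == b).
Proof.
rewrite /GRing.mul /= /ga_mul raddf_sum /=; apply: eq_bigr => k1 _.
by rewrite raddf_sum /=; apply: eq_bigr => k2 _; rewrite mcoeffU.
Qed.

End GroupAlgebra.

(* ** The graded algebra G_v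

   It is built as the quotient of the Rees algebra, that is the direct sum of
   the P_b seen inside F[G], by the direct sum of the P_{b+}. *)

Section Rees.
Context {F : fieldType} {G : orderedGroupType} (v : valuation F G).

Definition rees_pred : {pred galg F G} :=
  [pred g | all (fun b => mcoeff b g \in vge v b) (msupp g)].

Lemma reesP (g : galg F G) :
  reflect (forall b, mcoeff b g \in vge v b) (g \in rees_pred).
Proof.
apply: (iffP allP) => [h b|h b _]; last exact: h.
by case: msuppP => [/h//|_]; exact: rpred0.
Qed.

Fact rees_subring : subring_closed rees_pred.
Proof.
split=> [|x y /reesP hx /reesP hy|x y /reesP hx /reesP hy]; apply/reesP => b.
- rewrite mcoeffU; case: eqVneq => [<-|_]; last exact: rpred0.
  by rewrite inE val1 lexx orbT.
- by rewrite mcoeffB rpredB.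
- rewrite ga_mcoeffM rpred_sum // => k1 _; rewrite rpred_sum // => k2 _.
  by case: eqVneq => [<-|_]; [exact: vgeM | exact: rpred0].
Qed.

Record rees := Rees { rees_val : galg F G; _ : rees_val \in rees_pred }.

HB.instance Definition _ := [isSub for rees_val].
HB.instance Definition _ := [Choice of rees by <:].
HB.instance Definition _ :=
  GRing.SubChoice_isSubComNzRing.Build (galg F G) rees_pred rees rees_subring.

Definition rees_coef (b : G) (g : rees) : F := mcoeff b (rees_val g).

Lemma rees_coefP b g : rees_coef b g \in vge v b.
Proof. by move: b; apply/reesP; exact: (valP g). Qed.

Definition rees_ideal : {pred rees} :=
  [pred g | all (fun b => rees_coef b g \in vgt v b) (msupp (rees_val g))].

Lemma rees_idealP g :
  reflect (forall b, rees_coef b g \in vgt v b) (g \in rees_ideal).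
Proof.
apply: (iffP allP) => [h b|h b _]; last exact: h.
by rewrite /rees_coef; case: msuppP => [/h//|_]; exact: rpred0.
Qed.

Lemma rees_coefD b g h : rees_coef b (g + h) = rees_coef b g + rees_coef b h.
Proof. by rewrite /rees_coef /= mcoeffD. Qed.

Lemma rees_coefM b g h : rees_coef b (g * h) =
  \sum_(k1 <- msupp (rees_val g)) \sum_(k2 <- msupp (rees_val h))
    (rees_coef k1 g * rees_coef k2 h) *+ (k1 + k2 == b).
Proof. exact: ga_mcoeffM. Qed.

Fact rees_ideal_closed : idealr_closed rees_ideal.
Proof.
split.
- by apply/rees_idealP => b; rewrite /rees_coef /= mcoeff0 rpred0.
- apply/negP => /rees_idealP /(_ 0).
  by rewrite /rees_coef /= mcoeffUU inE oner_eq0 val1 ltxx.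
- move=> a g h /rees_idealP hg /rees_idealP hh; apply/rees_idealP => b.
  rewrite rees_coefD rpredD // rees_coefM rpred_sum // => k1 _.
  rewrite rpred_sum // => k2 _.
  by case: eqVneq => [<-|_]; [exact: vgtMr (rees_coefP _ _) (hg _) | exact: rpred0].
Qed.

Lemma rees_leading g : g \notin rees_ideal -> exists b,
  rees_coef b g \notin vgt v b /\ (forall a, a < b -> rees_coef a g \in vgt v a).
Proof.
move=> /allPn /= [b0 b0s b0n].
have : forall s : seq G, (exists2 b, b \in s & rees_coef b g \notin vgt v b) ->
   exists2 b, rees_coef b g \notin vgt v b &
     forall a, a \in s -> a < b -> rees_coef a g \in vgt v a.
  elim=> [[]//|c s IH] _.
  have [cg|cn] := boolP (rees_coef c g \in vgt v c); last first.
    have [[b bs bn]|ns] := pselect (exists2 b, b \in s & rees_coef b g \notin vgt v b).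
      have [b' b'n b'm] := IH (ex_intro2 _ _ b bs bn).
      have [cb|bc] := boolP (c < b').
        exists c => // a; rewrite inE => /orP[/eqP->|ains ac]; first by rewrite ltxx.
        exact: b'm (lt_trans ac cb).
      exists b' => // a; rewrite inE => /orP[/eqP->|]; last exact: b'm.
      by rewrite (negPf bc).
    exists c => // a; rewrite inE => /orP[/eqP->|ains _]; first by rewrite ltxx.
    by apply/negPn/negP => an; apply: ns; exists a.
  have [[b bs bn]|ns] := pselect (exists2 b, b \in s & rees_coef b g \notin vgt v b).
    have [b' b'n b'm] := IH (ex_intro2 _ _ b bs bn).
    exists b' => // a; rewrite inE => /orP[/eqP->//|]; exact: b'm.
  exists b0 => // a; rewrite inE => /orP[/eqP->//|ains _].
  by apply/negPn/negP => an; apply: ns; exists a.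
move=> /(_ (msupp (rees_val g)) (ex_intro2 _ _ b0 b0s b0n)) [b bn bm].
exists b; split=> // a ab; have [as_|] := boolP (a \in msupp (rees_val g)).
  exact: bm.
by rewrite /rees_coef => /mcoeff_outdom ->; exact: rpred0.
Qed.

Fact rees_ideal_prime : prime_idealr_closed rees_ideal.
Proof.
move=> g h ghI; apply/negPn; rewrite negb_or; apply/negP.
case/andP=> /rees_leading[b [bn bm]] /rees_leading[c [cn cm]].
move/rees_idealP: ghI => /(_ (b + c)); rewrite rees_coefM.
have bs : b \in msupp (rees_val g).
  by apply: contraNT bn; rewrite /rees_coef => /mcoeff_outdom ->; exact: rpred0.
have cs : c \in msupp (rees_val h).
  by apply: contraNT cn; rewrite /rees_coef => /mcoeff_outdom ->; exact: rpred0.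
rewrite (big_fsetD1 b) //= (big_fsetD1 c) //= eqxx mulr1n.
have [b0 vb] := vgeNvgt (rees_coefP _ _) bn.
have [c0 vc] := vgeNvgt (rees_coefP _ _) cn.
rewrite -addrA rpredDr; first by rewrite inE mulf_eq0 (negPf b0) (negPf c0) valM // vb vc ltxx.
have off k1 k2 : (k1 != b) || (k2 != c) ->
    (rees_coef k1 g * rees_coef k2 h) *+ (k1 + k2 == b + c) \in vgt v (b + c).
  move=> ne; case: eqVneq => [e|_]; last exact: rpred0.
  rewrite -e mulr1n.
  case: (comparable_ltgtP (ocomparable k1 b)) => [lt1|gt1|e1].
  - exact: vgtMl (bm _ lt1) (rees_coefP _ _).
  - apply: vgtMr (rees_coefP _ _) (cm _ _).
    by rewrite oltNge; apply/negP => ck2; have := oltleD gt1 ck2; rewrite e ltxx.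
  - by move: ne e; rewrite e1 eqxx /= => ne /addrI e; rewrite e eqxx in ne.
rewrite rpredD //; first last.
  rewrite big_seq rpred_sum // => k1; rewrite in_fsetD1 => /andP[k1b _].
  by rewrite rpred_sum // => k2 _; rewrite off ?k1b.
rewrite big_seq rpred_sum // => k2; rewrite in_fsetD1 => /andP[k2c _].
by rewrite off ?k2c ?orbT.
Qed.

HB.instance Definition _ := isIdealr.Build rees rees_ideal rees_ideal_closed.
HB.instance Definition _ :=
  isPrimeIdealrClosed.Build rees rees_ideal rees_ideal_prime.

Definition gr := {ideal_quot rees_ideal}.

HB.instance Definition _ := Choice.on gr.
HB.instance Definition _ := GRing.ComNzRing.on gr.

Definition gr_unit : {pred gr} := [pred x | `[< exists y, y * x = 1 >]].
Definition gr_inv (x : gr) : gr :=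
  if pselect (exists y, y * x = 1) is left h then projT1 (cid h) else x.

Fact gr_mulVx : {in gr_unit, left_inverse 1 gr_inv *%R}.
Proof.
move=> x /asboolP h; rewrite /gr_inv.
case: pselect => [h'|nh]; first by case: cid.
by case: nh.
Qed.

Fact gr_unitPl x y : y * x = 1 -> gr_unit x.
Proof. by move=> yx; apply/asboolP; exists y. Qed.

Fact gr_inv_out : {in [predC gr_unit], gr_inv =1 id}.
Proof.
by move=> x /asboolPn nh; rewrite /gr_inv; case: pselect.
Qed.

HB.instance Definition _ := GRing.ComNzRing_hasMulInverse.Build gr
  gr_mulVx gr_unitPl gr_inv_out.

Fact gr_idomain (x y : gr) : x * y = 0 -> (x == 0) || (y == 0).
Proof. exact: (@Quotient.rquot_IdomainAxiom rees rees_ideal). Qed.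

HB.instance Definition _ := GRing.ComUnitRing_isIntegral.Build gr gr_idomain.

End Rees.

Arguments rees_ideal {F G} v _.

(* ** Homogeneous elements and initial forms *)

Section InitialForms.
Context {F : fieldType} {G : orderedGroupType} (v : valuation F G).

(* The class of y in P_b / P_{b+}, for y in P_b, and 0 for other y *)
Definition gr_class (b : G) (y : F) : gr v :=
  \pi_(gr v) (insubd (0 : rees v) (<< y *g b >> : galg F G)).

Definition initial_form (y : F) : gr v := gr_class (v y) y.

Definition homogeneous (h : gr v) : Prop := exists b y, h = gr_class b y.

Fact rees_class b y : y \in vge v b -> (<< y *g b >> : galg F G) \in rees_pred v.
Proof.
move=> yb; apply/reesP => c; rewrite mcoeffU.
by case: eqVneq => [<-//|_]; exact: rpred0.
Qed.

Lemma val_insub_class b y : y \in vge v b ->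
  rees_val (insubd (0 : rees v) (<< y *g b >> : galg F G)) = << y *g b >>.
Proof. by move=> yb; exact: (@insubdK _ _ (rees v) 0 _ (rees_class yb)). Qed.

Lemma rees_val_sum (I : Type) (r : seq I) (E : I -> rees v) :
  rees_val (\sum_(i <- r) E i) = \sum_(i <- r) rees_val (E i).
Proof. exact: (big_morph (@rees_val F G v) (id1 := 0) (op1 := +%R)). Qed.

Lemma gr_class_pi b y (g : rees v) : y \in vge v b -> rees_val g = << y *g b >> ->
  gr_class b y = \pi_(gr v) g.
Proof.
by move=> yb e; congr (\pi_(gr v) _); apply: val_inj; rewrite /= val_insub_class.
Qed.

Lemma pi_gr_eq0 (g : rees v) : (\pi_(gr v) g == 0) = (g \in rees_ideal v).
Proof. by rewrite -[0](rmorph0 \pi_(gr v)) -Quotient.idealrBE subr0. Qed.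

Lemma gr_classD b : {in vge v b &, {morph gr_class b : x y / x + y}}.
Proof.
move=> x y xb yb; rewrite -[RHS](rmorphD \pi_(gr v)).
by apply: gr_class_pi; rewrite /= ?rpredD // !val_insub_class // monalgUD.
Qed.

Lemma gr_class0 b : gr_class b 0 = 0.
Proof.
rewrite (@gr_class_pi b 0 0) ?rpred0 ?rmorph0 //=.
by rewrite monalgU0.
Qed.

Lemma gr_classM b c : {in vge v b & vge v c,
  forall x y, gr_class (b + c) (x * y) = gr_class b x * gr_class c y}.
Proof.
move=> x y xb yc; rewrite -[RHS](rmorphM \pi_(gr v)).
apply: gr_class_pi; rewrite /= ?vgeM // !val_insub_class //.
by rewrite -ga_mulUU.
Qed.

Lemma gr_class1 : gr_class 0 1 = 1.
Proof.
rewrite -[RHS](rmorph1 \pi_(gr v)); apply: gr_class_pi => //.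
by rewrite inE val1 lexx orbT.
Qed.

Lemma gr_class_eq0 b y : y \in vge v b -> (gr_class b y == 0) = (y \in vgt v b).
Proof.
move=> yb; rewrite pi_gr_eq0; apply/rees_idealP/idP => [/(_ b)|yb' c].
  by rewrite /rees_coef val_insub_class // mcoeffUU.
rewrite /rees_coef val_insub_class // mcoeffU.
by case: eqVneq => [<-//|_]; exact: rpred0.
Qed.

Lemma gr_pi_sum (g : rees v) (d : {fset G}) :
  (msupp (rees_val g) `<=` d)%fset ->
  \pi_(gr v) g = \sum_(b <- d) gr_class b (rees_coef b g).
Proof.
move=> gd; rewrite -[RHS](rmorph_sum \pi_(gr v)); congr (\pi_(gr v) _).
apply: val_inj; rewrite [RHS]rees_val_sum.
rewrite [LHS](monalgEw gd); apply: eq_bigr => b _.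
by rewrite val_insub_class // rees_coefP.
Qed.

(* G_v is the sum of its components P_b / P_{b+} ... *)
Lemma gr_sum_class (x : gr v) : exists (d : {fset G}) (y : G -> F),
  (forall b, y b \in vge v b) /\ x = \sum_(b <- d) gr_class b (y b).
Proof.
exists (msupp (rees_val (repr x))), (fun b => rees_coef b (repr x)).
by split=> [b|]; [exact: rees_coefP | rewrite -gr_pi_sum ?reprK].
Qed.

(* ... and this sum is direct. *)
Lemma gr_sum_direct (d : {fset G}) (y : G -> F) :
  (forall b, b \in d -> y b \in vge v b) -> \sum_(b <- d) gr_class b (y b) = 0 ->
  forall b, b \in d -> gr_class b (y b) = 0.
Proof.
move=> yd; rewrite -[LHS](rmorph_sum \pi_(gr v)) => /eqP; rewrite pi_gr_eq0.
move=> /rees_idealP h b bd; apply/eqP; rewrite gr_class_eq0 ?yd //.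
move: (h b); rewrite /rees_coef rees_val_sum raddf_sum.
rewrite /= (big_fsetD1 b) //= val_insub_class ?yd // mcoeffUU big_seq big1 ?addr0 //.
move=> c; rewrite in_fsetD1 => /andP[cb cd].
by rewrite val_insub_class ?yd // mcoeffU (negPf cb).
Qed.

End InitialForms.

(* ** The natural map between graded algebras induced by an extension of valued
   fields *)

Section GrMap.
Context {K F : fieldType} {G : orderedGroupType}.
Variables (f : {rmorphism K -> F}) (v : valuation F G).
Local Notation w := (pull_val f v).

Definition gr_map (x : gr w) : gr v :=
  \sum_(b <- msupp (rees_val (repr x))) gr_class v b (f (rees_coef b (repr x))).

Lemma pull_vge b c : (f c \in vge v b) = (c \in vge w b).
Proof. by rewrite !inE fmorph_eq0. Qed.

Lemma pull_vgt b c : (f c \in vgt v b) = (c \in vgt w b).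
Proof. by rewrite !inE fmorph_eq0. Qed.

Lemma gr_map_pi (g : rees w) (d : {fset G}) : (msupp (rees_val g) `<=` d)%fset ->
  gr_map (\pi_(gr w) g) = \sum_(b <- d) gr_class v b (f (rees_coef b g)).
Proof.
move=> gd; set r := repr (\pi_(gr w) g); set e := (d `|` msupp (rees_val r))%fset.
have rg : r - g \in rees_ideal w.
  by rewrite Quotient.idealrBE reprK.
have widen (h : rees w) (d' : {fset G}) : (msupp (rees_val h) `<=` d')%fset ->
    (d' `<=` e)%fset ->
    \sum_(b <- d') gr_class v b (f (rees_coef b h)) =
    \sum_(b <- e) gr_class v b (f (rees_coef b h)).
  move=> hd' d'e; apply: big_fset_incl => // b _ bd'.
  rewrite /rees_coef mcoeff_outdom ?rmorph0 ?gr_class0 //.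
  by apply: contra bd' => /(fsubsetP hd').
rewrite /gr_map -/r (widen r) ?fsubsetUr ?fsubset_refl // (widen g) ?fsubsetUl //.
apply: eq_bigr => b _; have -> : r = (r - g) + g by rewrite subrK.
rewrite rees_coefD rmorphD gr_classD ?pull_vge ?rees_coefP //.
have /eqP -> : gr_class v b (f (rees_coef b (r - g))) == 0; last by rewrite add0r.
by rewrite gr_class_eq0 ?pull_vge ?rees_coefP // pull_vgt; exact/rees_idealP.
Qed.

Lemma gr_map_class b c : c \in vge w b ->
  gr_map (gr_class w b c) = gr_class v b (f c).
Proof.
move=> cb; rewrite (@gr_map_pi _ [fset b]%fset) ?val_insub_class ?msuppU_le //.
by rewrite big_seq_fset1 /rees_coef val_insub_class // mcoeffUU.
Qed.

Lemma gr_map_initial c : gr_map (initial_form w c) = initial_form v (f c).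
Proof. by apply: gr_map_class; rewrite inE lexx orbT. Qed.

Fact gr_map_zmod : zmod_morphism gr_map.
Proof.
have addm x y : gr_map (x + y) = gr_map x + gr_map y.
  rewrite -[x]reprK -[y]reprK -rmorphD /=.
  set g := repr x; set h := repr y.
  pose d := (msupp (rees_val g) `|` msupp (rees_val h))%fset.
  rewrite !(@gr_map_pi _ d) ?fsubsetUl ?fsubsetUr ?msuppD_le // -big_split /=.
  apply: eq_bigr => b _.
  by rewrite rees_coefD rmorphD gr_classD ?pull_vge ?rees_coefP.
by move=> x y; apply/eqP; rewrite -subr_eq opprK -addm subrK.
Qed.

HB.instance Definition _ := GRing.isZmodMorphism.Build (gr w) (gr v) gr_map gr_map_zmod.

Fact gr_map_monoid : monoid_morphism gr_map.
Proof.
split.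
  rewrite -(gr_class1 w) gr_map_class ?rmorph1 ?gr_class1 //.
  by rewrite inE val1 lexx orbT.
move=> x y; have [d [s [sv ->]]] := gr_sum_class x.
have [e [t [tv ->]]] := gr_sum_class y.
rewrite mulr_suml !raddf_sum mulr_suml; apply: eq_bigr => b _.
rewrite mulr_sumr !raddf_sum mulr_sumr; apply: eq_bigr => c _ /=.
rewrite -gr_classM // !gr_map_class ?vgeM // rmorphM gr_classM //.
  by rewrite pull_vge.
by rewrite pull_vge.
Qed.

HB.instance Definition _ :=
  GRing.isMonoidMorphism.Build (gr w) (gr v) gr_map gr_map_monoid.

Lemma gr_map_inj : injective gr_map.
Proof.
apply: raddf_inj => x; have [d [s [sv ->]]] := gr_sum_class x.
rewrite raddf_sum => h; rewrite big_seq big1 // => b bd; apply/eqP.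
rewrite gr_class_eq0 // -pull_vgt -gr_class_eq0 ?pull_vge //; apply/eqP.
apply: (@gr_sum_direct _ _ v d (fun b => f (s b))) => // [c _|].
  by rewrite pull_vge.
by rewrite -[RHS]h; apply: eq_bigr => c _; rewrite /= gr_map_class.
Qed.

End GrMap.

Arguments gr_map {K F G} f v x.

(* ** Values *)

Section Values.
Context {F : fieldType} {G : orderedGroupType}.

(* Values in G together with infinity, encoded as [None] *)
Definition le_ext (a b : option G) : bool :=
  match a, b with
  | _, None => true
  | None, Some _ => false
  | Some a', Some b' => a' <= b'
  end.
Definition lt_ext (a b : option G) : bool := ~~ le_ext b a.
Definition min_ext (a b : option G) : option G := if le_ext a b then a else b.

Definition ext_val (v : valuation F G) (y : F) : option G :=
  if y == 0 then None else Some (v y).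

Definition value_group (v : valuation F G) : set G := [set v y | y in [set y | y != 0]].

Definition is_subgroup (H : set G) : Prop :=
  H 0 /\ forall a b, H a -> H b -> H (a - b).

Definition isolated_subgroup (H0 H : set G) : Prop :=
  [/\ is_subgroup H, H `<=` H0 &
      forall a b, H b -> H0 a -> 0 <= a -> a <= b -> H a].

(* Rank one: a nontrivial value group whose only proper isolated subgroup is 0 *)
Definition rank_one (v : valuation F G) : Prop :=
  value_group v <> [set 0] /\
  forall H, isolated_subgroup (value_group v) H ->
    H = [set 0] \/ H = value_group v.

(* The elements of G which lie in H \otimes Q, as elements of G \otimes Q *)
Definition div_hull (H : set G) : set G :=
  [set b | exists2 n : nat, (0 < n)%N & H (b *+ n)].

(* Boundedness from above in H \otimes Q: an element of H \otimes Q is a quotient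
   h / n, and b <= h / n means n b <= h. *)
Definition bounded_in_hull (H B : set G) : Prop :=
  exists (h : G) (n : nat), [/\ H h, (0 < n)%N & forall b, B b -> b *+ n <= h].

End Values.

(* ** Algebraic relations *)

Definition is_subring (R : comNzRingType) (S : set R) : Prop :=
  [/\ S 1, forall x y, S x -> S y -> S (x - y) &
      forall x y, S x -> S y -> S (x * y)].

Definition subring_generated (R : comNzRingType) (X : set R) : set R :=
  smallest (@is_subring R) X.

Definition poly_over (R : comNzRingType) (S : set R) (p : {poly R}) : Prop :=
  forall k, S p`_k.

Definition transcendental_over (R : comNzRingType) (S : set R) (u : R) : Prop :=
  forall p : {poly R}, poly_over S p -> p != 0 -> ~ root p u.

Definition minimal_relation (R : comNzRingType) (S : set R) (u : R) (p : {poly R}) : Prop :=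
  [/\ p \is monic, poly_over S p, root p u &
      forall q : {poly R}, poly_over S q -> q != 0 -> root q u -> (size p <= size q)%N].

(* The algebra G^* of a graded subalgebra of G_v, inside the fraction field of G_v *)
Definition graded_fractions (F : fieldType) (G : orderedGroupType)
    (v : valuation F G) (S : set (gr v)) : set {fraction (gr v)} :=
  [set y | exists g h, [/\ S g, S h, h != 0, homogeneous h &
     y = FracField.tofrac g / FracField.tofrac h]].

(* ** Well ordered index sets *)

Section Indices.
Context {disp : Order.disp_t} {L : bOrderType disp}.
Implicit Types i j k : L.

Definition is_max i : Prop := forall j, (j <= i)%O.

Definition is_succ i j : Prop := (i < j)%O /\ forall k, (i < k)%O -> (j <= k)%O.

(* j = i + t *)
Fixpoint is_shift i (t : nat) j : Prop :=
  if t is t'.+1 then exists2 k, is_shift i t' k & is_succ k j else j = i.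

(* j = i + omega *)
Definition is_omega_shift i j : Prop :=
  (forall t, exists2 k, is_shift i t k & (k < j)%O) /\
  (forall j', (forall t k, is_shift i t k -> (k < j')%O) -> (j <= j')%O).

Section Plus.
(* These notions are relative to an initial segment D of L. *)
Variables (D : set L) (alpha : L -> nat).

Definition inessential i : Prop :=
  (exists2 j, D j & is_omega_shift i j) /\
  forall t k, is_shift i t k -> alpha k = 1%N.

(* i+ = j *)
Definition is_plus i j : Prop :=
  D j /\ (inessential i /\ is_omega_shift i j \/ ~ inessential i /\ is_succ i j).

End Plus.

Definition upto (l : L) : set L := [set q | (q <= l)%O].

End Indices.

(* ** Key polynomials *)

Section KeyPolynomials.
Context {K : fieldType} {G : orderedGroupType}.
Context {disp : Order.disp_t} {L : bOrderType disp}.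

Local Notation Kx := {fraction {poly K}}.
Local Notation "p %:F" := (FracField.tofrac p).

Definition scalar_frac : {rmorphism K -> Kx} := (@FracField.tofrac _) \o polyC.

Variables (v : valuation Kx G) (alpha : L -> nat) (Q : L -> {poly K}).

Definition base_val : valuation K G := pull_val scalar_frac v.

(* Gamma_0 \otimes Q, cut down to G *)
Definition tGamma0 : set G := div_hull (value_group base_val).

Definition beta (i : L) : G := v (Q i)%:F.

Definition deg (p : {poly K}) : nat := (size p).-1.

Record pre_key_polynomials : Prop := {
  alpha_gt0 : forall i, (0 < alpha i)%N;
  alpha_bot : alpha \bot%O = 1%N;
  pre_key_monic : forall i, Q i \is monic;
  pre_key_bot : Q \bot%O = 'X;
  pre_key_deg : forall i i0, ~ is_max i -> i != \bot%O -> (i0 < i)%O ->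
    is_plus setT alpha i0 i -> deg (Q i) = (alpha i * deg (Q i0))%N
}.

(* The monomial prod_q Q_q ^ (g q) *)
Definition Qmon (g : {cmonom L}) : {poly K} := \prod_(q <- finsupp g) Q q ^+ g q.

Definition standard_monomial (l : L) (g : {cmonom L}) : Prop :=
  [/\ forall q, g q != 0%N -> (q <= l)%O,
      forall q j, (q < l)%O -> is_plus (upto l) alpha q j -> (g q < alpha j)%N &
      forall q k j j', inessential (upto l) alpha q -> is_plus (upto l) alpha q k ->
        is_plus (upto l) alpha j k -> is_plus (upto l) alpha j' k ->
        g j != 0%N -> g j' != 0%N -> j = j'].

Definition free_standard_monomial (l : L) (g : {cmonom L}) : Prop :=
  standard_monomial l g /\ g l = 0%N.

(* A finite sum of monomials c_g * Qmon g is given by the formal polynomial e with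
   coefficients e@_g = c_g, so that the monomials are those of [msupp e]. *)
Definition formal := {malg K[{cmonom L}]}.

Definition Qterm (e : formal) (g : {cmonom L}) : {poly K} := e@_g *: Qmon g.

Definition Qeval (e : formal) : {poly K} := \sum_(g <- msupp e) Qterm e g.

Definition free_standard_expansion (l : L) (e : formal) : Prop :=
  (forall g, g \in msupp e -> free_standard_monomial l g) /\
  ext_val v (Qeval e)%:F =
    \big[min_ext/None]_(g <- msupp e) ext_val v (Qterm e g)%:F.

(* h = sum_(j <= n) c_j Q_l^j is an l-standard expansion of h. *)
Definition standard_expansion (l : L) (n : nat) (c : nat -> formal) (h : {poly K}) : Prop :=
  (forall j, (j <= n)%N -> free_standard_expansion l (c j)) /\
  h = \sum_(j < n.+1) Qeval (c j) * Q l ^+ j.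

Definition expansion_min (l : L) (n : nat) (c : nat -> formal) : option G :=
  \big[min_ext/None]_(j < n.+1) ext_val v (Qeval (c j) * Q l ^+ j)%:F.

(* G_{nu_K}[in Q_q, q < i], as a subring of G_nu *)
Definition gr_adjoin (i : L) : set (gr v) :=
  subring_generated (range (gr_map scalar_frac v) `|`
    [set initial_form v (Q q)%:F | q in [set q | (q < i)%O]]).

(* sum_g in(c_g) in(M_g) *)
Definition initial_sum (e : formal) : gr v :=
  \sum_(g <- msupp e)
    gr_map scalar_frac v (initial_form base_val e@_g) * initial_form v (Qmon g)%:F.

Definition initial_relation (n : nat) (c : nat -> formal) : {poly {fraction (gr v)}} :=
  'X^n + \sum_(j < n) (FracField.tofrac (initial_sum (c j)))%:P * 'X^j.

Definition key_successor (p i : L) : Prop :=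
  exists c : nat -> formal,
  [/\ forall j, (j < alpha i)%N -> free_standard_expansion p (c j),
      Q i = Q p ^+ alpha i + \sum_(j < alpha i) Qeval (c j) * Q p ^+ j,
      forall j g, (j < alpha i)%N -> g \in msupp (c j) ->
        v (Qterm (c j) g * Q p ^+ j)%:F = v (Q p ^+ alpha i)%:F &
      minimal_relation (graded_fractions (gr_adjoin p))
        (FracField.tofrac (initial_form v (Q p)%:F)) (initial_relation (alpha i) c)].

Definition limit_property (i : L) (f : {poly K}) : Prop :=
  forall i0, is_plus setT alpha i0 i ->
    (exists n c, standard_expansion i0 n c f) /\
    forall n c, standard_expansion i0 n c f ->
      lt_ext (expansion_min i0 n c) (ext_val v f%:F).

Definition key_limit (i : L) : Prop :=
  [/\ exists i0, is_plus setT alpha i0 i,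
      forall i0, is_plus setT alpha i0 i ->
        (exists c, standard_expansion i0 (alpha i) c (Q i)) /\
        forall c, standard_expansion i0 (alpha i) c (Q i) ->
          lt_ext (expansion_min i0 (alpha i) c) (ext_val v (Q i)%:F),
      forall f, limit_property i f -> (deg (Q i) <= deg f)%N &
      bounded_in_hull (value_group base_val) [set beta i' | i' in [set i' | (i' < i)%O]] \/
          ~ is_max i ->
        forall i0, is_plus setT alpha i0 i ->
        forall c, standard_expansion i0 (alpha i) c (Q i) ->
          [/\ Qeval (c (alpha i)) = 1,
              expansion_min i0 (alpha i) c = Some (beta i0 *+ alpha i) &
              ext_val v (Qeval (c 0%N))%:F = Some (beta i0 *+ alpha i)]].

Record key_polynomials : Prop := {
  key_pre : pre_key_polynomials;
  key_value : forall i, ~ is_max i -> tGamma0 (beta i);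
  key_succ : forall p i, is_succ p i -> key_successor p i;
  key_lim : forall i, i != \bot%O -> (forall p, ~ is_succ p i) -> key_limit i;
  key_cofinal : forall n, infinite_set [set i | deg (Q i) = n] ->
    forall f : {poly K}, f \is monic -> deg f = n ->
      exists i, deg (Q i) = n /\ v f%:F <= beta i
}.

End KeyPolynomials.

Arguments gr_adjoin {K G disp L} v Q i _.

(* Main.v *)
Require Import Defs.
From mathcomp Require Import all_boot all_order all_algebra.
From mathcomp Require Import boolp classical_sets cardinality wochoice.
From mathcomp Require Import fraction.
From mathcomp Require Import finmap monalg ring_quotient.

(* The algebra G_{nu_K}[in Q_q, q < i] lives in degrees of the divisible hull
   of the value group of nu_K, because every Q_q with q < i has its value
   there.  As no positive multiple of beta_i lies in this hull, the terms
   p_k (in Q_i)^k of a relation p(in Q_i) = 0 live in pairwise disjoint cosets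
   of degrees; the sum of the homogeneous components being direct, each term
   vanishes, hence so does each p_k, since G_nu is a domain. *)

Local Open Scope classical_set_scope.
Local Open Scope ring_scope.
Local Open Scope quotient_scope.
Import Order.TTheory GRing.Theory.
Set Implicit Arguments.
Unset Strict Implicit.
Unset Printing Implicit Defensive.

(** * Divisible hulls of subgroups and the cosets of multiples of an element outside them *)

Section Subgroups.
Context {G : orderedGroupType} (H : set G) (Hsub : is_subgroup H).

Lemma subgroup0 : H 0. Proof. exact: Hsub.1. Qed.

Lemma subgroupB a b : H a -> H b -> H (a - b). Proof. exact: Hsub.2. Qed.

Lemma subgroupD a b : H a -> H b -> H (a + b).
Proof.
move=> Ha Hb; rewrite -[b]opprK; apply: subgroupB => //.
by rewrite -sub0r; apply: subgroupB => //; exact: subgroup0.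
Qed.

Lemma subgroupMn a n : H a -> H (a *+ n).
Proof.
move=> Ha; elim: n => [|n IH]; first by rewrite mulr0n; exact: subgroup0.
by rewrite mulrS; exact: subgroupD.
Qed.

Lemma div_hull_subset : H `<=` div_hull H.
Proof. by move=> a Ha; exists 1%N. Qed.

(** The product [m * n] serves as a common denominator. *)
Lemma div_hull_subgroup : is_subgroup (div_hull H).
Proof.
split; first exact: div_hull_subset subgroup0.
move=> a b [m m0 Ha] [n n0 Hb]; exists (m * n)%N; first by rewrite muln_gt0 m0.
rewrite mulrnBl mulrnA mulnC mulrnA.
by apply: subgroupB; exact: subgroupMn.
Qed.

Lemma div_hullMn a n : (0 < n)%N -> div_hull H (a *+ n) -> div_hull H a.
Proof.
by move=> n0 [m m0 Ha]; exists (n * m)%N; rewrite ?muln_gt0 ?n0 // mulrnA.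
Qed.

(** If [k < l], subtracting the two elements of the hull leaves [a *+ (l - k)]; the hull is closed
    under division by positive integers, so it would contain [a]. *)
Lemma coset_mulrn_disjoint a b k l : ~ div_hull H a ->
  div_hull H (b - a *+ k) -> div_hull H (b - a *+ l) -> k = l.
Proof.
move=> aH; wlog kl : k l / (k <= l)%N => [hw hk hl|].
  by have [/hw|/ltnW/hw h] := leqP k l; [exact | apply/esym/h].
move=> hk hl; apply/eqP; rewrite eqn_leq kl /= leqNgt; apply/negP => lt_kl.
apply/aH/(@div_hullMn _ (l - k)%N); first by rewrite subn_gt0.
have -> : a *+ (l - k) = (b - a *+ k) - (b - a *+ l).
  by rewrite mulrnBr // opprB [RHS]addrC addrA subrK.
exact: div_hull_subgroup.2.
Qed.

End Subgroups.

Lemma value_group_subgroup (F : fieldType) (G : orderedGroupType)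
  (v : valuation F G) : is_subgroup (value_group v).
Proof.
split; first by exists 1; [exact: oner_neq0 | rewrite Defs.val1].
move=> _ _ [x /= x0 <-] [y /= y0 <-].
exists (x / y); first by rewrite /= mulf_neq0 ?invr_eq0.
by rewrite -[X in _ = v X - _](divfK y0) [in RHS]Defs.valM ?mulf_neq0 ?invr_eq0 // addrK.
Qed.

(** * Degrees in which an element of the graded algebra lives *)

Section Support.
Context {F : fieldType} {G : orderedGroupType} (v : valuation F G).
Implicit Types (x y : gr v) (A B C : set G).

(* The homogeneous components of x outside the degrees in A vanish. *)
Definition supported A x : Prop :=
  forall b, ~ A b -> rees_coef b (repr x) \in vgt v b.

(** Two representatives of a class differ by an element of the ideal, all of whose coefficients lie
    in P_{b+}. Hence [supported] does not depend on the representative chosen by [repr]. *)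
Lemma repr_pi_coef (g : rees v) b :
  (rees_coef b (repr (\pi_(gr v) g)) \in vgt v b) = (rees_coef b g \in vgt v b).
Proof.
set r := repr _; have : r - g \in rees_ideal v.
  by rewrite Quotient.idealrBE reprK.
move=> /rees_idealP/(_ b) rg.
by rewrite -[r](subrK g) rees_coefD rpredDl.
Qed.

Lemma supported_pi A (g : rees v) :
  supported A (\pi_(gr v) g) <-> forall b, ~ A b -> rees_coef b g \in vgt v b.
Proof. by split=> h b /h; rewrite repr_pi_coef. Qed.

Lemma supportedS A B x : A `<=` B -> supported A x -> supported B x.
Proof. by move=> AB h b nB; apply: h => /AB. Qed.

Lemma supported0 A : supported A 0.
Proof.
rewrite -(rmorph0 \pi_(gr v)); apply/supported_pi => b _.
by rewrite /rees_coef /= mcoeff0 rpred0.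
Qed.

Lemma supportedD A x y : supported A x -> supported A y -> supported A (x + y).
Proof.
rewrite -[x]reprK -[y]reprK -rmorphD => /supported_pi hx /supported_pi hy.
by apply/supported_pi => b nA; rewrite rees_coefD rpredD ?hx ?hy.
Qed.

Lemma supportedN A x : supported A x -> supported A (- x).
Proof.
rewrite -[x]reprK -rmorphN => /supported_pi hx; apply/supported_pi => b nA.
by rewrite /rees_coef /= mcoeffN rpredN; exact: hx.
Qed.

(** If [k1 + k2] is outside [C], then [k1] is outside [A] or [k2] is outside [B]; the corresponding
    factor has a value above its degree, hence so does the product. *)
Lemma supportedM A B C x y : (forall a b, A a -> B b -> C (a + b)) ->
  supported A x -> supported B y -> supported C (x * y).
Proof.
move=> ABC; rewrite -[x]reprK -[y]reprK -rmorphM.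
move=> /supported_pi hx /supported_pi hy; apply/supported_pi => b nC.
rewrite rees_coefM rpred_sum // => k1 _; rewrite rpred_sum // => k2 _.
case: eqVneq => [e|_]; last exact: rpred0.
rewrite mulr1n -e; have [Ak1|nAk1] := pselect (A k1); last first.
  exact: vgtMl (hx _ nAk1) (rees_coefP _ _).
apply: vgtMr (rees_coefP _ _) (hy _ _) => Bk2.
by apply: nC; rewrite -e; exact: ABC.
Qed.

Lemma supported_class b c : c \in vge v b -> supported [set b] (gr_class v b c).
Proof.
move=> cb; apply/supported_pi => a nab.
rewrite /rees_coef val_insub_class // mcoeffU.
by case: eqVneq => [/esym/nab|_] //; exact: rpred0.
Qed.

Lemma supported1 : supported [set 0] 1.
Proof. by rewrite -(gr_class1 v); apply: supported_class; rewrite inE Defs.val1 lexx orbT. Qed.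

Lemma supported_initial_form c : supported [set v c] (initial_form v c).
Proof. by apply: supported_class; rewrite inE lexx orbT. Qed.

Lemma supportedX x a n : supported [set a] x -> supported [set a *+ n] (x ^+ n).
Proof.
move=> hx; elim: n => [|n IH]; first by rewrite mulr0n expr0; exact: supported1.
by rewrite exprS; apply: supportedM hx IH => _ _ -> ->; rewrite mulrS.
Qed.

Lemma supported_subring A : is_subgroup A -> is_subring (supported A).
Proof.
move=> As; split=> [|x y hx hy|x y].
- by apply: supportedS supported1 => _ ->; exact: subgroup0.
- by apply: supportedD => //; exact: supportedN.
- by apply: supportedM => a b; exact: subgroupD.
Qed.

(** In a degree of [A i] no other summand has a component, so there the component of [x i] is that
    of the whole sum, which vanishes. *)
Lemma supported_sum_eq0 (I : finType) (A : I -> set G) (x : I -> gr v) :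
  (forall i j b, A i b -> A j b -> i = j) -> (forall i, supported (A i) (x i)) ->
  \sum_i x i = 0 -> forall i, x i = 0.
Proof.
move=> disj hx s0 i; apply/eqP; rewrite -[x i]reprK pi_gr_eq0.
apply/rees_idealP => b; have [Aib|] := pselect (A i b); last exact: hx.
have : \sum_j repr (x j) \in rees_ideal v.
  rewrite -pi_gr_eq0 rmorph_sum /= -[X in _ == X]s0.
  by apply/eqP/eq_bigr => j _; exact: reprK.
move/rees_idealP/(_ b).
rewrite (bigD1 i) //= rees_coefD rpredDr //.
apply: (big_ind (fun g => rees_coef b g \in vgt v b)) => [|g h hg hh|j ji].
- by rewrite /rees_coef /= mcoeff0 rpred0.
- by rewrite rees_coefD rpredD.
- by apply: hx => Ajb; rewrite (disj _ _ _ Ajb Aib) eqxx in ji.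
Qed.

Lemma initial_form_neq0 c : c != 0 -> initial_form v c != 0.
Proof. by move=> c0; rewrite gr_class_eq0 inE ?lexx ?orbT // ltxx orbF. Qed.

End Support.

(** A coefficient in degree [b] either has value above [b] and a zero class, or has value exactly
    [b], which is then a value of the subfield. *)
Lemma supported_gr_map (K F : fieldType) (G : orderedGroupType)
    (f : {rmorphism K -> F}) (v : valuation F G) (x : gr (pull_val f v)) :
  supported (value_group (pull_val f v)) (gr_map f v x).
Proof.
rewrite /gr_map; apply: big_ind => [||b _].
- exact: supported0.
- exact: supportedD.
have cb := rees_coefP b (repr x); set c := rees_coef b _ in cb *.
have [cgt|] := boolP (c \in vgt (pull_val f v) b).
  suff /eqP -> : gr_class v b (f c) == 0 by exact: supported0.
  by rewrite gr_class_eq0 ?pull_vge // pull_vgt.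
move=> /(vgeNvgt cb) [c0 vc].
apply: (@supportedS _ _ _ [set b]) => [_ ->|]; first by exists c.
by apply: supported_class; rewrite pull_vge.
Qed.

(** * Transcendence from the disjointness of cosets *)

Lemma transcendental_supported (F : fieldType) (G : orderedGroupType)
    (v : valuation F G) (H : set G) (S : set (gr v)) (c : F) :
  is_subgroup H -> S `<=` supported (div_hull H) -> c != 0 ->
  ~ div_hull H (v c) -> transcendental_over S (initial_form v c).
Proof.
move=> Hs SH c0 nHc p Sp p0 /rootP; rewrite horner_coef => hp.
(* The term of index [k] lives in the coset of [v c *+ k] modulo the hull. *)
have h := @supported_sum_eq0 _ _ v _
  (fun k : 'I_(size p) => [set b | div_hull H (b - v c *+ k)]) _ _ _ hp.
have sp : (0 < size p)%N by rewrite size_poly_gt0.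
have /h : forall (k l : 'I_(size p)) b,
    div_hull H (b - v c *+ k) -> div_hull H (b - v c *+ l) -> k = l.
  by move=> k l b hk hl; apply: val_inj; exact: (coset_mulrn_disjoint Hs nHc hk hl).
(* The leading term suffices: its coefficient is nonzero, so in a domain it cannot vanish. *)
have lt_p : ((size p).-1 < size p)%N by rewrite prednK.
move=> /(_ _ (Ordinal lt_p))/= h0.
have /eqP : p`_(size p).-1 * initial_form v c ^+ (size p).-1 = 0.
  apply: h0 => k.
  apply: supportedM (SH _ (Sp k)) (supportedX (@supported_initial_form _ _ v c)).
  by move=> a _ Ha -> /=; rewrite addrK.
by rewrite mulf_eq0 lead_coef_eq0 (negPf p0) expf_eq0
  (negPf (initial_form_neq0 _ c0)) andbF.
Qed.

Theorem proposition3p35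
  (K : fieldType) (G : orderedGroupType) (v : valuation {fraction {poly K}} G)
  (disp : Order.disp_t) (L : bOrderType disp)
  (alpha : L -> nat) (Q : L -> {poly K}) :
  value_group v = [set: G] ->
  rank_one (base_val v) ->
  0 < v (FracField.tofrac 'X) ->
  countable [set: L] ->
  well_order (fun i j : L => (i <= j)%O) ->
  key_polynomials v alpha Q ->
  forall i : L, is_max i -> ~ tGamma0 v (beta v Q i) ->
    transcendental_over (gr_adjoin v Q i)
      (initial_form v (FracField.tofrac (Q i))).
Proof.
move=> _ _ _ _ _ keyQ i _ nbeta.
have Gs := value_group_subgroup (base_val v).
apply: (transcendental_supported Gs) nbeta; last first.
  by rewrite tofrac_eq0 monic_neq0 // (pre_key_monic (key_pre keyQ)).
(* Elements supported in the hull form a subring, so only the generators need checking. *)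
apply: smallest_sub => [|x [[y _ <-]|[q /= qi <-]]].
- exact/supported_subring/div_hull_subgroup.
- apply: (@supportedS _ _ v (value_group (base_val v))).
    exact: div_hull_subset.
  exact: (@supported_gr_map _ _ _ (scalar_frac (K := K)) v).
- apply: supportedS (@supported_initial_form _ _ v _) => _ ->.
  (* Since [q < i], the index [q] is not maximal, so its value lies in the hull. *)
  by apply: (key_value keyQ) => /(_ i); rewrite leNgt qi.
Qed.
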